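(* For all integers $n,m\ge0$, \[ \mathcal{C}_{n,m}^{(k)}(a,q,L)=\frac{(a+m)^k}{l^{m}a^{k}}\sum_{j=0}^{m}\left\{ {m+n \atop j+n} \right\}_{n} q^{m-j}\,c_{n+j}^{(k)}(a,q,L), \] and $\mathcal{C}_{n,0}^{(k)}(a,q,L)=c_n^{(k)}(a,q,L)$.
   Context: Let $k\ge1$ be an integer, let $a,q,l_1,\dots,l_k$ be nonzero reals, $L=(l_1,\dots,l_k)$, $l=\prod_{i=1}^k l_i$; denominators $a+j$ ($j\ge0$ integer) are assumed nonzero and $l^{a+i}$ means $l^a l^i$. Let $s(n,i)$ be the signed Stirling numbers of the first kind ($\frac{1}{i!}(\ln(1+x))^i=\sum_{n\ge i}s(n,i)\frac{x^n}{n!}$). The generalized poly-Cauchy numbers of the first kind are $c_n^{(k)}(a,q,L)=\sum_{i=0}^n s(n,i)\frac{q^{n-i}l^{a+i}}{(a+i)^k}$, and the generalized $m$-poly-Cauchy numbers of the first kind are \[ \mathcal{C}_{n,m}^{(k)}(a,q,L)=\frac{(a+m)^k}{a^k}\sum_{i=0}^{n}s(n,i)\frac{q^{n-i}l^{a+i}}{(a+i+m)^k}. \] The $r$-Stirling numbers of the second kind $\left\{ {n \atop i} \right\}_r$ are defined by $\sum_{n\ge i}\left\{ {n+r \atop i+r} \right\}_r\frac{z^n}{n!}=\frac{1}{i!}e^{rz}(e^z-1)^i$ for integers $r,i\ge0$. *)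

(* Defs.v *)
From mathcomp Require Import all_boot all_order all_algebra.
From mathcomp Require Import complex.
From mathcomp Require Import all_classical all_reals all_analysis.

Set Implicit Arguments.
Unset Strict Implicit.
Unset Printing Implicit Defensive.

Import Order.TTheory GRing.Theory Num.Theory.
Local Open Scope ring_scope.
Local Open Scope complex_scope.

(* Formal power series over F, as coefficient sequences [nat -> F]. *)
Section FormalPowerSeries.
Variable F : numFieldType.

Definition fps1 (n : nat) : F := (n == 0%N)%:R.

Definition fps_mul (f g : nat -> F) (n : nat) : F :=
  \sum_(i < n.+1) f i * g (n - i)%N.

Definition fps_pow (f : nat -> F) (i : nat) : nat -> F :=
  iter i (fps_mul f) fps1.

(* ln (1 + x) = x - x^2/2 + x^3/3 - ... *)
Definition fps_ln1p (n : nat) : F :=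
  if n is p.+1 then (-1) ^+ p / p.+1%:R else 0.

(* e^(r z) *)
Definition fps_exp (r n : nat) : F := r%:R ^+ n / n`!%:R.

(* e^z - 1 *)
Definition fps_expm1 (n : nat) : F := fps_exp 1 n - fps1 n.

(* n! [x^n] of (ln (1 + x))^i / i! *)
Definition stirling1 (n i : nat) : F :=
  n`!%:R * (fps_pow fps_ln1p i n / i`!%:R).

(* The generating function determines {n, i}_r for n, i >= r, as
   (n - r)! [z^(n - r)] of e^(r z) (e^z - 1)^(i - r) / (i - r)!;
   the value 0 elsewhere is a convention. *)
Definition rstirling2 (r n i : nat) : F :=
  if (r <= n)%N && (r <= i)%N then
    (n - r)`!%:R *
      (fps_mul (fps_exp r) (fps_pow fps_expm1 (i - r)) (n - r)%N
        / (i - r)`!%:R)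
  else 0.

End FormalPowerSeries.

Section PolyCauchy.
Variable R : realType.

Definition cexp (z : R[i]) : R[i] :=
  (expR (complex.Re z) * cos (complex.Im z))
    +i* (expR (complex.Re z) * sin (complex.Im z)).

(* w is a determination of l^a, i.e., w = exp (a * lam) for some complex
   logarithm lam of l.  A product of nonzero reals may be negative, in which
   case l^a need not be real (and [powR l a] is a junk value). *)
Definition pow_value (l a : R) (w : R[i]) : Prop :=
  exists2 lam : R[i], cexp lam = l%:C & w = cexp (a%:C * lam).

Variables (k : nat) (a q : R) (L : k.-tuple R).

Definition lprod : R := \prod_(i < k) tnth L i.

(* In the three definitions below, la stands for the chosen value of l^a. *)
Variable la : R[i].

Definition lpow (i : nat) : R[i] := la * (lprod ^+ i)%:C.

Definition polyCauchy (n : nat) : R[i] :=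
  \sum_(i < n.+1)
     (stirling1 R n i)%:C
       * ((q ^+ (n - i))%:C * lpow i / ((a + i%:R) ^+ k)%:C).

Definition mpolyCauchy (n m : nat) : R[i] :=
  ((a + m%:R) ^+ k / a ^+ k)%:C *
  \sum_(i < n.+1)
     (stirling1 R n i)%:C
       * ((q ^+ (n - i))%:C * lpow i / ((a + i%:R + m%:R) ^+ k)%:C).

End PolyCauchy.

Lemma pow_value_powR (R : realType) (l a : R) :
  0 < l -> pow_value l a (l `^ a)%:C.
Proof.
move=> l0; exists (ln l)%:C; rewrite /cexp /=.
  by rewrite cos0 sin0 mulr1 mulr0 lnK.
by rewrite !(mul0r, mulr0, subr0, addr0) cos0 sin0 mulr1 mulr0 /powR gt_eqF.
Qed.

Lemma pow_value_exists (R : realType) (l a : R) :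
  l != 0 -> exists w, pow_value l a w.
Proof.
move=> l0; have [l_gt0|l_le0] := ltP 0 l.
  by exists (l `^ a)%:C; exact: pow_value_powR.
have l_lt0 : 0 < - l by rewrite oppr_gt0 lt_neqAle l0.
eexists; exists (ln (- l) +i* pi); last by [].
by rewrite /cexp /= cospi sinpi mulr0 lnK// mulrN1 opprK.
Qed.

(* Main.v *)
Require Import Defs.
From mathcomp Require Import all_boot all_order all_algebra.
From mathcomp Require Import complex.
From mathcomp Require Import all_classical all_reals all_analysis.
From mathcomp Require Import ring.

Set Implicit Arguments.
Unset Strict Implicit.
Unset Printing Implicit Defensive.

Import Order.TTheory GRing.Theory Num.Theory.
Local Open Scope ring_scope.
Local Open Scope complex_scope.

(** Let [P_n = X (X - q) ... (X - (n - 1) q)], so that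
    [P_n = \sum_i s(n, i) q^(n - i) X^i]. The linear functional
    [phi : X^i |-> l^(a + i) / (a + i)^k] sends [P_n] to [c_n] and [X^m P_n] to
    [l^m] times the sum defining [C_(n, m)]. The theorem is the image under
    [phi] of [X^m P_n = \sum_j {m + n, j + n}_n q^(m - j) P_(n + j)], which
    follows by induction on [m] from [X P_i = P_(i + 1) + i q P_i] and the
    triangular recurrence of the r-Stirling numbers. Both Stirling recurrences
    come from differentiating the generating functions. *)

(** * Algebra and derivations of formal power series *)

Section FormalPowerSeriesTheory.
Variable F : numFieldType.
Implicit Types (f g h : nat -> F) (d : (nat -> F) -> nat -> F).

(** Truncating to polynomials lets the product inherit commutativity and associativity from
    [{poly F}]. *)
Lemma fps_mul_coefM f g (n N : nat) : (n < N)%N ->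
  fps_mul f g n = ((\poly_(i < N) f i) * (\poly_(i < N) g i))`_n.
Proof.
move=> nN; rewrite coefM; apply: eq_bigr => i _.
rewrite !coef_poly (leq_ltn_trans (leq_subr i n) nN).
by rewrite (leq_ltn_trans _ nN) // -ltnS.
Qed.

Lemma fps_mulC f g : fps_mul f g = fps_mul g f.
Proof. by apply/funext => n; rewrite !(fps_mul_coefM _ _ (ltnSn n)) mulrC. Qed.

Lemma fps_mulA f g h :
  fps_mul f (fps_mul g h) = fps_mul (fps_mul f g) h.
Proof.
apply/funext => n; pose T u := \poly_(i < n.+1) (u i : F).
transitivity ((T f * (T g * T h))`_n).
  rewrite coefM; apply: eq_bigr => i _; rewrite coef_poly ltn_ord.
  by rewrite -fps_mul_coefM // ltnS leq_subr.
rewrite mulrA coefM; apply: eq_bigr => i _.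
by rewrite coef_poly ltnS leq_subr -fps_mul_coefM.
Qed.

Lemma fps_mul1 f : fps_mul f (@fps1 F) = f.
Proof.
apply/funext => n; rewrite fps_mulC /fps_mul big_ord_recl subn0 mul1r.
by rewrite big1 ?addr0 // => i _; rewrite mul0r.
Qed.

Lemma fps_mulDr f g h :
  fps_mul f (fun n => g n + h n) = fun n => fps_mul f g n + fps_mul f h n.
Proof.
by apply/funext => n; rewrite -big_split; apply: eq_bigr => i _; rewrite mulrDr.
Qed.

Lemma fps_mulZr f (c : F) g :
  fps_mul f (fun n => c * g n) = fun n => c * fps_mul f g n.
Proof.
by apply/funext => n; rewrite big_distrr; apply: eq_bigr => i _; rewrite mulrCA.
Qed.

Definition fps_euler f (n : nat) : F := n%:R * f n.

Definition fps_deriv f (n : nat) : F := n.+1%:R * f n.+1.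

(** Kept abstract so that one power rule serves both d/dx, for exponentials, and (1 + x) d/dx = d/dx
    + x d/dx, for the logarithm. *)
Definition fps_derivation d : Prop :=
  d (@fps1 F) = (fun=> 0) /\
  forall f g, d (fps_mul f g) = fun n => fps_mul (d f) g n + fps_mul f (d g) n.

Lemma fps_derivation_euler : fps_derivation fps_euler.
Proof.
split=> [|f g]; apply/funext => n.
  by rewrite /fps_euler /fps1; case: n => [|n]; rewrite ?mul0r ?mulr0.
rewrite /fps_euler /fps_mul -big_split big_distrr; apply: eq_bigr => i _ /=.
have -> : n%:R = i%:R + (n - i)%:R :> F.
  by rewrite -natrD subnKC // -ltnS.
ring.
Qed.

Lemma fps_derivation_deriv : fps_derivation fps_deriv.
Proof.
split=> [|f g]; apply/funext => n; first by rewrite /fps_deriv mulr0.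
(* The coefficient of x^n in f' is that of x^(n + 1) in x f', so the Leibniz rule for x d/dx is read
   one index higher; each sum then loses a zero end term. *)
have [_ /(_ f g) /(congr1 (fun u => u n.+1))] := fps_derivation_euler.
rewrite /fps_euler /fps_deriv => ->; congr (_ + _).
  rewrite /fps_mul big_ord_recl !mul0r add0r.
  by apply: eq_bigr => i _; rewrite subSS.
rewrite /fps_mul big_ord_recr /= subnn mul0r mulr0 addr0.
by apply: eq_bigr => i _; rewrite subSn // -ltnS.
Qed.

Lemma fps_derivationD d e : fps_derivation d -> fps_derivation e ->
  fps_derivation (fun f n => d f n + e f n).
Proof.
move=> [d1 dM] [e1 eM]; split=> [|f g]; apply/funext => n.
  by rewrite d1 e1 addr0.
by rewrite dM eM fps_mulDr !(fps_mulC _ g) fps_mulDr addrACA.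
Qed.

Lemma fps_derivation_pow d f (i : nat) : fps_derivation d ->
  d (fps_pow f i.+1) = fun n => i.+1%:R * fps_mul (fps_pow f i) (d f) n.
Proof.
move=> [d1 dM]; elim: i => [|i IHi]; apply/funext => n.
  by rewrite /= fps_mul1 fps_mulC fps_mul1 mul1r.
rewrite [fps_pow f i.+2]/= -/(fps_pow f i.+1) dM IHi fps_mulZr.
rewrite (fps_mulA f (fps_pow f i)) (fps_mulC (d f)).
by rewrite -[i.+2%:R in RHS]natr1 mulrDl mul1r addrC.
Qed.

Lemma fps_powS_coef0 f (i : nat) : f 0%N = 0 -> fps_pow f i.+1 0%N = 0.
Proof. by move=> f0; rewrite /= /fps_mul big_ord1 f0 mul0r. Qed.

End FormalPowerSeriesTheory.

(** * Triangular recurrences for both kinds of Stirling numbers *)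

Section StirlingRecurrences.
Variable F : numFieldType.

Lemma fact_natr_neq0 (n : nat) : n`!%:R != 0 :> F.
Proof. by rewrite pnatr_eq0 -lt0n fact_gt0. Qed.

Lemma stirling1_00 : stirling1 F 0 0 = 1.
Proof. by rewrite /stirling1 /= /fps1 divr1 mulr1. Qed.

Lemma stirling1_0S (i : nat) : stirling1 F 0 i.+1 = 0.
Proof. by rewrite /stirling1 fps_powS_coef0 // mul0r mulr0. Qed.

Lemma stirling1_S0 (n : nat) : stirling1 F n.+1 0 = 0.
Proof. by rewrite /stirling1 /= /fps1 mul0r mulr0. Qed.

(* The derivation [(1 + x) d/dx] maps [ln (1 + x)] to [1]. *)
Lemma stirling1_SS (n i : nat) :
  stirling1 F n.+1 i.+1 = stirling1 F n i - n%:R * stirling1 F n i.+1.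
Proof.
pose d f n := fps_deriv f n + fps_euler f n : F.
have dd : fps_derivation d.
  exact: fps_derivationD (fps_derivation_deriv F) (fps_derivation_euler F).
have d_ln : d (@fps_ln1p F) = @fps1 F.
  apply/funext => -[|p]; rewrite /d /fps_deriv /fps_euler /fps_ln1p /fps1 /=.
    by rewrite mul0r addr0 expr0 divr1 mulr1.
  by rewrite exprS; field; rewrite nat1r -natrD !pnatr_eq0.
have := fps_derivation_pow (@fps_ln1p F) i dd.
rewrite d_ln fps_mul1 => /(congr1 (fun u => u n)).
rewrite /d /fps_deriv /fps_euler /stirling1 !factS !natrM => E.
(* The factor i + 1 from the power rule is absorbed by (i + 1)! / i!. *)
have -> : fps_pow (@fps_ln1p F) i n =
  (n.+1%:R * fps_pow (@fps_ln1p F) i.+1 n.+1 +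
     n%:R * fps_pow (@fps_ln1p F) i.+1 n) / i.+1%:R.
  by rewrite E mulrC mulKf // pnatr_eq0.
by field; rewrite ?nat1r ?fact_natr_neq0 ?pnatr_eq0.
Qed.

Lemma stirling1_gt (n i : nat) : (n < i)%N -> stirling1 F n i = 0.
Proof.
elim: n i => [|n IHn] [|i] // ni; first exact: stirling1_0S.
by rewrite stirling1_SS !IHn ?mulr0 ?subr0 // ltnW.
Qed.

Lemma rstirling2_addE (r m j : nat) : rstirling2 F r (m + r) (j + r) =
  m`!%:R * (fps_mul (fps_exp F r) (fps_pow (@fps_expm1 F) j) m / j`!%:R).
Proof. by rewrite /rstirling2 !leq_addl !addnK. Qed.

Lemma rstirling2_00 (r : nat) : rstirling2 F r (0 + r) (0 + r) = 1.
Proof. by rewrite rstirling2_addE fps_mul1 /fps_exp !divr1 mulr1. Qed.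

Lemma rstirling2_0S (r j : nat) : rstirling2 F r (0 + r) (j.+1 + r) = 0.
Proof.
rewrite rstirling2_addE /fps_mul big_ord1 fps_powS_coef0 ?mulr0 ?mul0r ?mulr0 //.
by rewrite /fps_expm1 /fps_exp /fps1 divr1 subrr.
Qed.

Lemma fps_deriv_exp (r : nat) :
  fps_deriv (fps_exp F r) = fun n => r%:R * fps_exp F r n.
Proof.
apply/funext => n; rewrite /fps_deriv /fps_exp factS natrM exprS.
by field; rewrite ?nat1r ?fact_natr_neq0 ?pnatr_eq0.
Qed.

(** Writing e^z as (e^z - 1) + 1 keeps derivatives of powers of e^z - 1 expressed in such powers. *)
Lemma fps_deriv_expm1 :
  fps_deriv (@fps_expm1 F) = fun n => fps_expm1 F n + fps1 F n.
Proof.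
apply/funext => n; rewrite /fps_expm1 subrK.
have := congr1 (fun u => u n) (fps_deriv_exp 1).
by rewrite /fps_deriv /fps1 subr0 mul1r.
Qed.

Lemma rstirling2_S0 (r m : nat) :
  rstirling2 F r (m.+1 + r) (0 + r) = r%:R * rstirling2 F r (m + r) (0 + r).
Proof.
rewrite !rstirling2_addE !fps_mul1 /fps_exp exprS !divr1.
by field; rewrite !fact_natr_neq0.
Qed.

(** With u = e^z - 1, the derivative of e^(rz) u^(j + 1) is (r + j + 1) e^(rz) u^(j + 1) + (j + 1)
    e^(rz) u^j; compare coefficients of z^m. *)
Lemma rstirling2_SS (r m j : nat) :
  rstirling2 F r (m.+1 + r) (j.+1 + r) =
  rstirling2 F r (m + r) (j + r) +
    (r + j.+1)%:R * rstirling2 F r (m + r) (j.+1 + r).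
Proof.
rewrite !rstirling2_addE.
have dd := fps_derivation_deriv F.
have := dd.2 (fps_exp F r) (fps_pow (@fps_expm1 F) j.+1).
rewrite (fps_derivation_pow _ _ dd) fps_deriv_exp fps_deriv_expm1.
rewrite fps_mulDr fps_mul1.
rewrite (fps_mulC _ (@fps_expm1 F)) -/(fps_pow _ j.+1) fps_mulZr fps_mulDr.
rewrite (fps_mulC (fun n => _ * _)) fps_mulZr (fps_mulC _ (fps_exp F r)).
move=> /(congr1 (fun u => u m)); rewrite {1}/fps_deriv => E.
rewrite !factS !natrM mulrACA [_.+1%:R * _]mulrC -!mulrA.
rewrite [m.+1%:R * (_ * _)]mulrA E natrD.
by field; rewrite ?nat1r ?fact_natr_neq0 ?pnatr_eq0.
Qed.

Lemma rstirling2_gt (r m j : nat) : (m < j)%N ->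
  rstirling2 F r (m + r) (j + r) = 0.
Proof.
elim: m j => [|m IHm] [|j] // mj; first exact: rstirling2_0S.
by rewrite rstirling2_SS !IHm ?mulr0 ?addr0 // ltnW.
Qed.

End StirlingRecurrences.

(** * Expansion of X^m P_n in the polynomials P_(n + j) *)

Section FallingPolynomials.
Variables (F : numFieldType) (q : F).

Definition falling_poly (n : nat) : {poly F} :=
  \prod_(i < n) ('X - (i%:R * q)%:P).

Lemma falling_polyS (n : nat) :
  falling_poly n.+1 = falling_poly n * ('X - (n%:R * q)%:P).
Proof. by rewrite /falling_poly big_ord_recr. Qed.

(* For [i > n] the exponent is truncated, but then [stirling1 F n i = 0]. *)
Lemma coef_falling_poly (n i : nat) :
  (falling_poly n)`_i = stirling1 F n i * q ^+ (n - i).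
Proof.
elim: n i => [|n IHn] i.
  rewrite /falling_poly big_ord0 coef1 mulr1.
  by case: i => [|i]; rewrite ?stirling1_00 ?stirling1_0S.
rewrite falling_polyS mulrBr coefB coefMX coefMC.
case: i => [|i] /=; rewrite !IHn.
  case: n {IHn} => [|n]; rewrite !stirling1_S0; last by rewrite !mul0r subr0.
  by rewrite !mul0r mulr0 subr0.
rewrite stirling1_SS subSS mulrBl; congr (_ - _).
have [ni|ni] := leqP n i; first by rewrite stirling1_gt // mulr0 !mul0r.
by rewrite -(subnSK ni) exprS; ring.
Qed.

Lemma mulXn_falling_poly (n m : nat) :
  'X^m * falling_poly n =
  \sum_(j < m.+1)
     (rstirling2 F n (m + n) (j + n) * q ^+ (m - j)) *: falling_poly (n + j).
Proof.
elim: m => [|m IHm].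
  by rewrite big_ord1 rstirling2_00 addn0 mulr1 scale1r mul1r.
have mulX i : 'X * falling_poly i
    = falling_poly i.+1 + (i%:R * q) *: falling_poly i.
  by rewrite falling_polyS -mul_polyC; ring.
rewrite exprS -mulrA IHm big_distrr /=.
under eq_bigr => j _ do rewrite -scalerAr mulX scalerDr scalerA -addnS.
rewrite big_split /= [RHS]big_ord_recl /= rstirling2_S0.
under [X in _ = _ + X]eq_bigr => j _.
  rewrite /bump add1n rstirling2_SS subSS mulrDl scalerDl.
  over.
rewrite big_split /= addrCA; congr (_ + _).
(* The terms in P_(n + j + 1) with coefficient {m + n, j + n}_n have cancelled. The remaining sums
   differ by an index shift: the left one yields its j = 0 term, and the last term on the right
   vanishes. *)
rewrite big_ord_recl [in RHS]big_ord_recr /= (rstirling2_gt F n (ltnSn m)).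
rewrite mulr0 mul0r scale0r addr0 addn0 !subn0; congr (_ + _).
  by congr (_ *: _); rewrite exprS; ring.
apply: eq_bigr => j _; congr (_ *: _); rewrite /bump /= add1n.
by rewrite -(subnSK (ltn_ord j)) exprS; ring.
Qed.

End FallingPolynomials.

(** * Poly-Cauchy numbers as values of the functional *)

Section PolyCauchyFunctional.
Variables (R : realType) (k : nat) (a q : R) (L : k.-tuple R) (la : R[i]).

(* The functional [phi] on polynomials of size at most [N]. *)
Definition cauchy_functional (N : nat) (p : {poly R}) : R[i] :=
  \sum_(i < N) (p`_i)%:C * (lpow L la i / ((a + i%:R) ^+ k)%:C).

Lemma cauchy_functional_sum (N m : nat) (c : 'I_m -> R)
    (p : 'I_m -> {poly R}) :
  cauchy_functional N (\sum_(j < m) c j *: p j) =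
  \sum_(j < m) (c j)%:C * cauchy_functional N (p j).
Proof.
under [RHS]eq_bigr => j _ do rewrite /cauchy_functional big_distrr.
rewrite exchange_big; apply: eq_bigr => i _ /=.
rewrite coef_sum rmorph_sum big_distrl; apply: eq_bigr => j _ /=.
by rewrite coefZ rmorphM -mulrA.
Qed.

(** P_n has no coefficients beyond degree n, so [N] is free and a single functional can evaluate
    every P_(n + j) at once. *)
Lemma polyCauchyE (N n : nat) : (n < N)%N ->
  polyCauchy a q L la n = cauchy_functional N (falling_poly q n).
Proof.
move=> nN; rewrite /cauchy_functional -(subnKC nN) big_split_ord /=.
rewrite [X in _ = _ + X]big1 ?addr0 => [|i _].
  apply: eq_bigr => i _; rewrite coef_falling_poly [(_ * q ^+ _)%:C]rmorphM.
  by rewrite -!mulrA.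
by rewrite coef_falling_poly stirling1_gt ?mul0r // ltn_addr.
Qed.

(** Multiplying by X^m moves the coefficient at i to i + m, which turns a + i into a + i + m and
    l^(a + i) into l^m l^(a + i); the prefactor 1 / l^m compensates. *)
Lemma mpolyCauchyE (n m : nat) : lprod L != 0 ->
  mpolyCauchy a q L la n m =
  ((a + m%:R) ^+ k / (lprod L ^+ m * a ^+ k))%:C *
    cauchy_functional (m + n.+1) ('X^m * falling_poly q n).
Proof.
move=> l0; rewrite /cauchy_functional big_split_ord /= big1 ?add0r => [|i _].
  rewrite /mpolyCauchy invfM [_^-1 * _]mulrC mulrA [in RHS]rmorphM -mulrA.
  congr (_ * _); rewrite big_distrr; apply: eq_bigr => i _ /=.
  rewrite coefXnM ltnNge leq_addr /= addKn coef_falling_poly [(_ * q ^+ _)%:C]rmorphM.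
  rewrite /lpow exprD natrD [m%:R + _]addrC addrA.
  rewrite [(lprod L ^+ m * _)%:C]rmorphM /= rmorphV ?unitfE ?expf_neq0 //.
  have : (lprod L ^+ m)%:C != 0 :> R[i].
    by rewrite fmorph_eq0 expf_neq0.
  (* Naming the inverse denominator [v] leaves [field] only the condition that [u] is nonzero. *)
  set u := (lprod L ^+ m)%:C; set v := (_ ^+ k)%:C^-1 => u0.
  by rewrite -/u; field.
by rewrite coefXnM ltn_ord mul0r.
Qed.

End PolyCauchyFunctional.

Theorem theorem1 (R : realType) (k : nat) (a q : R) (L : k.-tuple R)
    (la : R[i])
    (hk : (1 <= k)%N) (ha : a != 0) (hq : q != 0)
    (hL : forall i : 'I_k, tnth L i != 0)
    (hden : forall j : nat, a + j%:R != 0)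
    (hla : pow_value (lprod L) a la) :
  forall n m : nat,
    mpolyCauchy a q L la n m =
      ((a + m%:R) ^+ k / (lprod L ^+ m * a ^+ k))%:C *
      \sum_(j < m.+1)
         (rstirling2 R n (m + n) (j + n) * q ^+ (m - j))%:C
           * polyCauchy a q L la (n + j)
    /\ mpolyCauchy a q L la n 0 = polyCauchy a q L la n.
Proof.
move=> n m; split.
  rewrite mpolyCauchyE; last by apply/prodf_neq0 => i _; exact: hL.
  rewrite mulXn_falling_poly cauchy_functional_sum; congr (_ * _).
  apply: eq_bigr => j _; rewrite -polyCauchyE //.
  (* Since j is at most m, n + j lies below the common bound m + n + 1. *)
  by rewrite addnS ltnS addnC leq_add2r -ltnS.
rewrite /mpolyCauchy addr0 divff ?expf_neq0 // mul1r.
by apply: eq_bigr => i _; rewrite addr0.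
Qed.
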